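(* For every positive integer $n$: (1) every graph $H$ with no isolated edge satisfies $\mathrm{sat}^*(n,H) \ge \mathrm{ssat}(n,H) \ge \left\lfloor \frac{n}{2} \right\rfloor$; (2) if $H$ is a connected graph containing a cycle, then $\mathrm{sat}^*(n,H) \ge \mathrm{ssat}(n,H)\ge n-1$.
   Context: All graphs are finite and simple. An isolated edge of a graph is a connected component isomorphic to $K_2$. An edge-colouring of a graph is proper if incident edges receive different colours, and a subgraph is rainbow if all of its edges receive pairwise distinct colours. A graph $G$ is properly rainbow $H$-saturated if (1) there is a proper edge-colouring of $G$ (with any set of colours) containing no rainbow copy of $H$, and (2) for every edge $e$ of the complement $\overline{G}$, every proper edge-colouring of $G+e$ contains a rainbow copy of $H$. The proper rainbow saturation number $\mathrm{sat}^*(n,H)$ is the minimum number of edges in an $n$-vertex properly rainbow $H$-saturated graph. A graph $G$ is $H$-semi-saturated if for every $e \in E(\overline{G})$, the graph $G+e$ contains a copy $H'$ of $H$ with $e \in E(H')$ ($G$ itself need not be $H$-free). $\mathrm{ssat}(n,H)$ is the minimum number of edges in an $H$-semi-saturated graph on $n$ vertices. *)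

(* Defs.v *)
From HB Require Import structures.
From mathcomp Require Import all_boot all_order all_algebra.
From mathcomp Require Import boolp constructive_ereal.

Set Implicit Arguments.
Unset Strict Implicit.
Unset Printing Implicit Defensive.

(* A finite simple graph on the vertex set T, given by its set of edges, each
   edge being an unordered pair of distinct vertices. *)
Record graph (T : finType) := Graph {
  edges : {set {set T}};
  edgesP : [forall e in edges, #|e| == 2] }.

HB.instance Definition _ (T : finType) := [isSub for @edges T].
HB.instance Definition _ (T : finType) := [Finite of graph T by <:].

Fact graph_of_subproof (T : finType) (E : {set {set T}}) :
  [forall e in [set e in E | #|e| == 2], #|e| == 2].
Proof. by apply/forall_inP => e; rewrite inE => /andP[]. Qed.

(* The members of E that are not pairs are discarded. *)
Definition graph_of (T : finType) (E : {set {set T}}) : graph T :=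
  Graph (graph_of_subproof E).

Definition complete (T : finType) : graph T := graph_of [set: {set T}].

Definition compl_graph (T : finType) (G : graph T) : graph T :=
  graph_of (~: edges G).

Definition add_edge (T : finType) (G : graph T) (e : {set T}) : graph T :=
  graph_of (e |: edges G).

Definition induced (T : finType) (G : graph T) (A : {set T}) :
    graph {x : T | x \in A} :=
  graph_of [set e : {set {x : T | x \in A}} | val @: e \in edges G].

Definition graph_iso (T U : finType) (G : graph T) (H : graph U) : Prop :=
  exists2 f : T -> U, bijective f &
    forall e : {set T}, (f @: e \in edges H) = (e \in edges G).

(* Irreflexive, since [set x; x] is not a pair. *)
Definition adj (T : finType) (G : graph T) : rel T :=
  [rel x y | [set x; y] \in edges G].

Definition component (T : finType) (G : graph T) (x : T) : {set T} :=
  [set y | connect (adj G) x y].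

Definition has_isolated_edge (T : finType) (G : graph T) : Prop :=
  exists x : T, graph_iso (induced G (component G x)) (complete 'I_2).

Definition connected (T : finType) (G : graph T) : Prop :=
  forall x y : T, connect (adj G) x y.

Definition has_cycle (T : finType) (G : graph T) : Prop :=
  exists2 s : seq T, 2 < size s & ucycle (adj G) s.

(* A copy of H in G is the (not necessarily induced) subgraph of G obtained as
   the image of H under an injective edge-preserving map; its edge set is
   copy_edges H f. *)
Definition embedding (U T : finType) (H : graph U) (G : graph T)
    (f : U -> T) : Prop :=
  injective f /\ (forall e, e \in edges H -> f @: e \in edges G).

Definition copy_edges (U T : finType) (H : graph U) (f : U -> T) :
    {set {set T}} :=
  [set f @: e | e : {set U} in edges H].

(* An edge-colouring of G with colours in C is a map c : {set T} -> C of which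
   only the values on edges G matter. *)
Definition proper_colouring (T : finType) (G : graph T) (C : Type)
    (c : {set T} -> C) : Prop :=
  forall e e' : {set T}, e \in edges G -> e' \in edges G ->
    e != e' -> e :&: e' != set0 -> c e <> c e'.

Definition rainbow (T : finType) (C : Type) (c : {set T} -> C)
    (F : {set {set T}}) : Prop :=
  {in F &, injective c}.

Definition has_rainbow_copy (U T : finType) (H : graph U) (G : graph T)
    (C : Type) (c : {set T} -> C) : Prop :=
  exists2 f : U -> T, embedding H G f & rainbow c (copy_edges H f).

Definition properly_rainbow_saturated (U T : finType) (H : graph U)
    (G : graph T) : Prop :=
  (exists C : Type, exists2 c : {set T} -> C,
     proper_colouring G c & ~ has_rainbow_copy H G c) /\
  (forall e : {set T}, e \in edges (compl_graph G) ->
     forall (C : Type) (c : {set T} -> C),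
       proper_colouring (add_edge G e) c ->
       has_rainbow_copy H (add_edge G e) c).

Definition semi_saturated (U T : finType) (H : graph U) (G : graph T) : Prop :=
  forall e : {set T}, e \in edges (compl_graph G) ->
    exists2 f : U -> T, embedding H (add_edge G e) f & e \in copy_edges H f.

(* Minimum number of edges of a graph on n vertices satisfying P, with the
   convention that the minimum over the empty family is +oo. *)
Definition min_edges (n : nat) (P : graph 'I_n -> Prop) : \bar int :=
  \big[Order.min/+oo%E]_(G : graph 'I_n | `[< P G >]) (#|edges G|%:Z)%:E.

Definition sat_star (n : nat) (U : finType) (H : graph U) : \bar int :=
  min_edges (fun G : graph 'I_n => properly_rainbow_saturated H G).

Definition ssat (n : nat) (U : finType) (H : graph U) : \bar int :=
  min_edges (fun G : graph 'I_n => semi_saturated H G).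

(* Main.v *)
(* In an H-semi-saturated graph G every new edge uv lies in a copy of H.
   If H has no isolated edge, G has at most one isolated vertex, for otherwise
   an edge joining two of them would be an isolated edge of its copy of H; hence
   G has at least floor(n/2) edges.
   If H is connected with a cycle, G has at most one acyclic component, for
   otherwise an edge joining two of them would create a copy of H, hence a
   cycle, inside a tree. To count edges without spanning trees, take a maximal
   set S spanning at least |S| edges: it is a union of components and no cycle
   of G avoids it, so all vertices outside S lie in one component. A maximal set
   containing S and one more vertex r, and spanning at least its cardinality
   minus one edges, is again a union of components, hence everything. *)
Require Import Defs.
From mathcomp Require Import all_boot all_order all_algebra.
From mathcomp Require Import boolp constructive_ereal.
From mathcomp Require Import zify.

Set Implicit Arguments.
Unset Strict Implicit.

(** * Edges, adjacency and added edges *)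

Lemma in_edges_graph_of (T : finType) (E : {set {set T}}) (e : {set T}) :
  (e \in edges (graph_of E)) = (#|e| == 2) && (e \in E).
Proof. by rewrite inE andbC. Qed.

Lemma card_edge (T : finType) (G : graph T) (e : {set T}) :
  e \in edges G -> #|e| = 2.
Proof. by move=> eG; apply/eqP; have /forall_inP := edgesP G; apply. Qed.

Lemma adj_sym (T : finType) (G : graph T) : symmetric (adj G).
Proof. by move=> x y; rewrite /adj /= setUC. Qed.

Lemma connect_adj_sym (T : finType) (G : graph T) : connect_sym (adj G).
Proof. exact: sym_connect_sym (@adj_sym T G). Qed.

Lemma adj_neq (T : finType) (G : graph T) (x y : T) : adj G x y -> x != y.
Proof. by move=> /card_edge; rewrite cards2; case: (x != y). Qed.

Lemma in_compl_graph (T : finType) (G : graph T) (u v : T) :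
  u != v -> ~~ adj G u v -> [set u; v] \in edges (compl_graph G).
Proof. by move=> uv nG; rewrite in_edges_graph_of cards2 uv inE. Qed.

Lemma adj_add_edge (T : finType) (G : graph T) (u v x y : T) :
  adj (add_edge G [set u; v]) x y ->
  (x = u /\ y = v) \/ (x = v /\ y = u) \/ adj G x y.
Proof.
move=> xy; have xNy := adj_neq xy.
move: xy; rewrite [adj _ _ _]in_edges_graph_of in_setU1 => /andP[_ /orP[/eqP E|]];
  last by right; right.
have: x \in [set u; v] by rewrite -E set21.
have: y \in [set u; v] by rewrite -E set22.
rewrite !in_set2 => /orP[]/eqP yE /orP[]/eqP xE; rewrite xE yE ?eqxx // in xNy *;
  by tauto.
Qed.

Lemma embedding_adj (U T : finType) (H : graph U) (G : graph T) (f : U -> T) :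
  embedding H G f -> {homo f : x y / adj H x y >-> adj G x y}.
Proof. by case=> _ fE x y /fE; rewrite imsetU1 imset_set1. Qed.

(** Orients the copied edge: injectivity of [f] excludes [f a = f b], and swapping [a] and [b] if
    needed sends them to [u] and [v] in this order. *)
Lemma semi_saturated_copy (U T : finType) (H : graph U) (G : graph T)
    (u v : T) :
  semi_saturated H G -> u != v -> ~~ adj G u v ->
  exists f a b, [/\ embedding H (add_edge G [set u; v]) f, adj H a b,
    f a = u & f b = v].
Proof.
move=> sG uv nuv; have [f fE /imsetP[e0 e0H E]] := sG _ (in_compl_graph uv nuv).
have /eqP/cards2P[a [b [ab e0E]]] := card_edge e0H; subst e0.
have fab : f a != f b by rewrite (inj_eq fE.1).
have: f a \in [set u; v] by rewrite E imset_f ?set21.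
have: f b \in [set u; v] by rewrite E imset_f ?set22.
rewrite !in_set2 => /orP[]/eqP fb /orP[]/eqP fa; rewrite ?fa ?fb ?eqxx // in fab.
  by exists f, b, a; split; rewrite // adj_sym.
by exists f, a, b.
Qed.

(* Giving the new edge a fresh colour keeps the colouring proper, so a rainbow
   copy of H avoiding the new edge would already be a rainbow copy in G. *)
Lemma properly_rainbow_saturated_semi (U T : finType) (H : graph U)
    (G : graph T) :
  properly_rainbow_saturated H G -> semi_saturated H G.
Proof.
case=> -[C [c cP cN]] sG e eG.
have eNG : e \notin edges G.
  by move: eG; rewrite in_edges_graph_of inE => /andP[].
pose c' (e' : {set T}) := if e' == e then None else Some (c e').
have inG e' : e' \in edges (add_edge G e) -> e' != e -> e' \in edges G.
  rewrite in_edges_graph_of in_setU1.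
  by move=> /andP[_ /orP[/eqP-> /eqP|]].
have c'P : proper_colouring (add_edge G e) c'.
  move=> e1 e2 e1G e2G e12 I; rewrite /c'.
  case: eqVneq => [E1|n1]; case: eqVneq => [E2|n2] //.
    by rewrite E1 E2 eqxx in e12.
  by case; apply: cP => //; apply: inG.
have [f fE fR] := sG e eG _ _ c'P.
exists f => //; apply: contrapT => /negP eN; apply: cN.
have neq e' : e' \in copy_edges H f -> e' != e.
  by move=> e'H; apply: contraNneq eN => <-.
exists f.
  split=> [|e' e'H]; first by case: fE.
  by apply: inG; [apply: fE.2 | apply: neq; apply: imset_f].
move=> e1 e2 e1H e2H E; apply: fR => //.
by rewrite /c' !ifN ?E // neq.
Qed.

(** * Graphs without an isolated edge *)

(** The pair [[set x; y]] is closed under adjacency, so it is the whole component of [x]. *)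
Lemma has_isolated_edgeI (U : finType) (H : graph U) (x y : U) :
  adj H x y -> (forall z, adj H x z -> z = y) ->
  (forall z, adj H y z -> z = x) -> has_isolated_edge H.
Proof.
move=> xy xN yN; exists x.
have comp : component H x = [set x; y].
  apply/setP=> z; rewrite in_set2 inE; apply/idP/orP => [xz|[]/eqP->].
  - have cl : closed (adj H) [set x; y].
      apply: (intro_closed (@connect_adj_sym _ H)) => a b ab.
      rewrite !in_set2 => /orP[]/eqP E; rewrite E in ab.
        by rewrite (xN _ ab) eqxx orbT.
      by rewrite (yN _ ab) eqxx.
    by have := closed_connect cl xz; rewrite set21 in_set2 => /esym/orP.
  - exact: connect0.
  - exact: connect1.
have cC : #|{: {z : U | z \in component H x}}| = 2.
  by rewrite card_sig comp cards2 (adj_neq xy).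
pose f (z : {z : U | z \in component H x}) : 'I_2 :=
  if val z == x then ord0 else ord_max.
have fI : injective f.
  move=> [z zP] [t tP] /= E; apply: val_inj => /=.
  move: E; rewrite /f /=; have := zP; have := tP; rewrite {1 2}comp !in_set2.
  by case: (eqVneq z x) => [->|_] /=; case: (eqVneq t x) => [->|_] //= /eqP-> /eqP->.
exists f; first by apply: inj_card_bij; rewrite // cC card_ord.
move=> e; rewrite !in_edges_graph_of inE andbT card_imset //.
case: eqP => [e2|] //=; rewrite inE.
(* The component has only two vertices, so a pair in it is everything. *)
have -> : e = setT by apply/eqP; rewrite eqEcard subsetT cardsT cC e2.
suff -> : [set val z | z in [set: {z : U | z \in component H x}]] = [set x; y].
  by rewrite (xy : _ \in _).
rewrite -comp; apply/setP=> z; apply/imsetP/idP => [[t _ ->]|zP].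
  exact: (valP t).
by exists (exist _ z zP).
Qed.

Lemma card_edges_semi_saturated (U T : finType) (H : graph U) (G : graph T) :
  ~ has_isolated_edge H -> semi_saturated H G -> #|T|./2 <= #|edges G|.
Proof.
move=> nH sG.
(* The complement of the cover is the set of isolated vertices. The edges cover at most
   [#|edges G| * 2] vertices, and the floor absorbs the remaining one. *)
have iso : #|~: cover (edges G)| <= 1.
  apply/card_le1_eqP => u v; rewrite !inE => uN vN.
  apply/eqP/negPn/negP => uv.
  have isol w z : w \notin cover (edges G) -> ~~ adj G w z.
    move=> wN; apply: contraNN wN => wz; apply/bigcupP; exists [set w; z] => //.
    exact: set21.
  rewrite eq_sym in uv.
  have [f [a [b [fE ab fa fb]]]] := semi_saturated_copy sG uv (isol _ _ uN).
  (* In the enlarged graph [u] and [v] are each other's only neighbours; injectivity of [f] pulls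
     this back to [a] and [b]. *)
  apply: nH; apply: (has_isolated_edgeI ab) => z.
    move=> /(embedding_adj fE) /adj_add_edge; rewrite fa => -[[_]|[[]|]].
    - by rewrite -fb => /fE.1.
    - by move=> E; rewrite E eqxx in uv.
    - by move=> h; have := isol _ (f z) uN; rewrite h.
  move=> /(embedding_adj fE) /adj_add_edge; rewrite fb => -[[]|[[_]|]].
  - by move=> E; rewrite E eqxx in uv.
  - by rewrite -fa => /fE.1.
  - by move=> h; have := isol _ (f z) vN; rewrite h.
have cov : #|cover (edges G)| <= #|edges G| * 2.
  rewrite -sum_nat_const (leq_trans (leq_card_cover _)) // leq_sum // => e.
  by move/card_edge->.
have := cardsC (cover (edges G)); rewrite -divn2.
by lia.
Qed.

(** * Dense vertex sets and cycles *)

Definition inner_edges (T : finType) (G : graph T) (S : {set T}) : {set {set T}} :=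
  [set e in edges G | e \subset S].

Lemma inner_edgesS (T : finType) (G : graph T) (A B : {set T}) :
  A \subset B -> inner_edges G A \subset inner_edges G B.
Proof.
move=> AB; apply/subsetP=> e; rewrite !inE => /andP[-> /subset_trans]; exact.
Qed.

Lemma card_inner_edgesU (T : finType) (G : graph T) (A B : {set T}) :
  [disjoint A & B] ->
  #|inner_edges G A| + #|inner_edges G B| <= #|inner_edges G (A :|: B)|.
Proof.
move=> dAB; rewrite -cardsUI.
rewrite [X in _ + X](_ : _ = 0) ?addn0; last first.
  apply/eqP; rewrite cards_eq0 -subset0; apply/subsetP=> e.
  rewrite !inE => /andP[/andP[eG eA] /andP[_ eB]].
  have : e \subset A :&: B by rewrite subsetI eA.
  rewrite (disjoint_setI0 dAB) subset0 => /eqP E.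
  by have := card_edge eG; rewrite E cards0.
by apply: subset_leq_card; rewrite subUset !inner_edgesS ?subsetUl ?subsetUr.
Qed.

(** The slack [k] is 0 for the part of the graph rich in cycles, and 1 once a possibly acyclic
    component is added. *)
Definition dense (T : finType) (G : graph T) (k : nat) (S : {set T}) : bool :=
  #|S| <= #|inner_edges G S| + k.

(** A neighbour outside [S] could be added: it costs one vertex and brings at least one edge. *)
Lemma maxset_dense_closed (T : finType) (G : graph T) k (S : {set T}) :
  maxset (dense G k) S -> closed (adj G) S.
Proof.
move=> mS; apply: (intro_closed (@connect_adj_sym _ G)) => y x yx yS.
apply/negPn/negP => xS.
suff dS : dense G k (x |: S).
  by move: xS; rewrite -(maxsetsup mS dS (subsetUr _ _)) setU11.
have /maxsetp := mS; rewrite /dense cardsU1 xS => dS.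
have lt : #|inner_edges G S| < #|inner_edges G (x |: S)|.
  apply/proper_card/properP; split; first exact/inner_edgesS/subsetUr.
  exists [set y; x].
    rewrite inE (yx : _ \in _) /= subUset !sub1set !in_setU1 yS eqxx orbT //.
  by rewrite inE negb_and subUset !sub1set (negPf xS) andbF orbT.
by lia.
Qed.

Lemma card_le_cycle_edges (T : finType) (G : graph T) (s : seq T) :
  2 < size s -> ucycle (adj G) s ->
  #|[set x in s]| <= #|inner_edges G [set x in s]|.
Proof.
move=> s2 /andP[sC sU].
(* With at least three vertices, two steps along the cycle do not return to [x]; this makes the map
   from [x] to the edge [[set x; next s x]] injective. *)
have next2 x : x \in s -> next s (next s x) != x.
  move=> /rot_to[i [|a [|b t]] E]; try by rewrite -(size_rot i s) E in s2.
  have := sU; rewrite -(rot_uniq i) E /=; rewrite !inE !negb_or.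
  case/andP=> /and3P[xa xb _] _.
  by rewrite -!(next_rot i sU) E /= eqxx [a == x]eq_sym (negPf xa) eqxx eq_sym.
rewrite -(card_in_imset (f := fun x => [set x; next s x])).
  apply: subset_leq_card; apply/subsetP=> e /imsetP[x]; rewrite inE => xs ->.
  rewrite inE (next_cycle sC xs : _ \in _) subUset !sub1set !inE mem_next.
  by rewrite xs.
move=> x y; rewrite !inE => xs ys E; apply/eqP/negPn/negP => xy.
have : x \in [set y; next s y] by rewrite -E set21.
have : y \in [set x; next s x] by rewrite E set21.
rewrite !in_set2 eq_sym (negPf xy) => /eqP yE /eqP xE.
by have := next2 x xs; rewrite -yE -xE eqxx.
Qed.

(** A cycle spans at least as many edges as vertices, so one disjoint from [S] could be added to
    [S]. *)
Lemma maxset_dense0_cycle (T : finType) (G : graph T) (S : {set T}) s :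
  maxset (dense G 0) S -> 2 < size s -> ucycle (adj G) s ->
  ~ {subset s <= ~: S}.
Proof.
move=> mS s2 sC sS.
have dj : [disjoint S & [set x in s]].
  rewrite disjoint_sym disjoints_subset; apply/subsetP=> x.
  by rewrite inE => /sS.
have le := card_le_cycle_edges s2 sC.
have dU : dense G 0 (S :|: [set x in s]).
  rewrite /dense addn0 (leq_trans _ (card_inner_edgesU _ dj)) // cardsU.
  by have := maxsetp mS; rewrite /dense; lia.
case: s s2 {sC le} sS dj dU => // x s _ sS _ /(maxsetsup mS) E.
have: x \in S by rewrite -(E (subsetUl _ _)) !inE eqxx orbT.
by move: (sS x (mem_head _ _)); rewrite inE => /negPf->.
Qed.

(** A cycle through the new edge would, without it, leave a path of [G] joining [u] and [v]. *)
Lemma ucycle_add_bridge (T : finType) (G : graph T) (u v : T) s :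
  ~~ connect (adj G) u v -> 2 < size s ->
  ucycle (adj (add_edge G [set u; v])) s -> ucycle (adj G) s.
Proof.
set G' := add_edge G _.
(* Here [a], [b] is the new edge in either direction. The last vertex [c] differs from [b] as [t] is
   nonempty, so the closing edge is old; the path from [b] to [c] avoids [a], so its edges are old
   too. *)
have key a b t : ~~ connect (adj G) a b ->
    (a = u /\ b = v \/ a = v /\ b = u) -> 0 < size t ->
    ~ ucycle (adj G') [:: a, b & t].
  move=> nab abE; elim/last_ind: t => // t c _ _.
  rewrite /ucycle /= rcons_path last_rcons rcons_path !inE !mem_rcons !inE.
  rewrite !negb_or => /andP[/and3P[_ /andP[pt lc] ca]].
  move=> /and3P[/and3P[ab ac at_] /andP[bc bt] _].
  have adjE x y : x != a -> y != a -> adj G' x y -> adj G x y.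
    move=> xa ya /adj_add_edge [[xE yE]|[[xE yE]|//]];
    by case: abE => -[aE bE]; rewrite ?xE ?yE ?aE ?bE eqxx in xa ya.
  have nota x : x \in b :: t -> x != a.
    rewrite inE => /orP[/eqP->|xt]; first by rewrite eq_sym.
    by apply: contraNneq at_ => <-.
  have pb : path (adj G) b t.
    apply: (@sub_in_path _ (mem (b :: t)) _ _ _ b t) pt; last exact/allP.
    by move=> x y xt yt; apply: adjE; apply: nota.
  have lE : adj G (last b t) c.
    by apply: adjE lc; [apply: nota; apply: mem_last | rewrite eq_sym].
  have cE : adj G c a.
    have /adj_add_edge[[cE aE]|[[cE aE]|//]] := ca;
    by case: abE => -[aE' bE']; rewrite ?cE ?aE' ?bE' eqxx in ac bc.
  case/negP: nab; rewrite connect_adj_sym.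
  apply: (connect_trans _ (connect1 cE)); apply: connect_trans (connect1 lE).
  by apply/connectP; exists t.
move=> nuv s2 sC; have /andP[cC sU] := sC; rewrite /ucycle sU andbT.
apply: cycle_from_next => // x xs.
have /adj_add_edge h := next_cycle cC xs.
suff E : ~ (x = u /\ next s x = v \/ x = v /\ next s x = u) by tauto.
move=> E; case: (rot_to xs) => i t rE.
case: t rE => [|y t] rE.
  by rewrite -(size_rot i s) rE in s2.
have yE : next s x = y by rewrite -(next_rot i sU) rE /= eqxx.
apply: (key x y t); rewrite -?yE //.
- by case: E => -[-> ->] //; rewrite connect_adj_sym.
- by rewrite -(size_rot i s) rE in s2.
- by rewrite yE -rE rot_ucycle.
Qed.

Lemma card_edges_semi_saturated_cycle (U T : finType) (H : graph U)
    (G : graph T) :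
  connected H -> has_cycle H -> semi_saturated H G -> #|T| <= #|edges G| + 1.
Proof.
move=> cH [s s2 sC] sG.
have full k : dense G k setT -> #|T| <= #|edges G| + k.
  rewrite /dense cardsT => /leq_trans-> //; rewrite leq_add2r.
  by apply: subset_leq_card; apply/subsetP=> e; rewrite inE => /andP[].
have [S mS _] : {S | maxset (dense G 0) S & set0 \subset S}.
  by apply: maxset_exists; rewrite /dense cards0.
have clS := maxset_dense_closed mS.
(* Adding an edge between components outside [S] keeps [S] closed, so the connected copy of [H]
   through [u] stays outside [S]. Its cycle cannot use the bridge, hence lies in [G] and avoids [S],
   against maximality. *)
have outS u v : u \notin S -> v \notin S -> connect (adj G) u v.
  move=> uS vS; apply/negPn/negP => nuv.
  have uv : u != v by apply: contraNneq nuv => ->; apply: connect0.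
  have nadj : ~~ adj G u v by apply: contraNN nuv => /connect1.
  have [f [a [b [fE _ fa _]]]] := semi_saturated_copy sG uv nadj.
  have clS' : closed (adj (add_edge G [set u; v])) S.
    move=> x y /adj_add_edge[[-> ->]|[[-> ->]|/clS//]].
      by rewrite (negPf uS) (negPf vS).
    by rewrite (negPf uS) (negPf vS).
  have fS z : f z \notin S.
    suff az : connect (adj (add_edge G [set u; v])) (f a) (f z).
      by rewrite -(closed_connect clS' az) fa.
    have /connectP[p pP ->] := cH a z.
    apply/connectP; exists (map f p); last by rewrite last_map.
    exact: (homo_path (embedding_adj fE) pP).
  have fC : ucycle (adj (add_edge G [set u; v])) (map f s).
    case/andP: sC => sC sU; rewrite /ucycle (map_inj_uniq fE.1) sU andbT.
    exact: (homo_cycle (embedding_adj fE)).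
  have f2 : 2 < size (map f s) by rewrite size_map.
  apply: (maxset_dense0_cycle mS f2 (ucycle_add_bridge nuv f2 fC)) => x.
  by case/mapP=> z _ ->; rewrite inE.
have [r rS|ST] := pickP [pred r | r \notin S]; last first.
  have {}ST : S = setT by apply/setP=> x; rewrite inE (negbFE (ST x)).
  by rewrite addn1 leqW // -[#|edges G|]addn0; apply: full; rewrite -ST (maxsetp mS).
(* The slack of 1 pays for the single vertex [r]. *)
have dr : dense G 1 (r |: S).
  have := maxsetp mS; have := subset_leq_card (inner_edgesS G (subsetUr [set r] S)).
  by rewrite /dense cardsU1 (rS : r \notin S); lia.
have [S' mS' /subsetP rS'] := maxset_exists dr.
(* [S'] is closed and contains [r], to which every vertex outside [S] is connected. *)
have ST : S' = setT.
  apply/setP=> x; rewrite inE; have [xS|xS] := boolP (x \in S).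
    by apply: rS'; rewrite inE xS orbT.
  rewrite -(closed_connect (maxset_dense_closed mS') (outS r x rS xS)).
  by apply: rS'; rewrite setU11.
by apply: full; rewrite -ST (maxsetp mS').
Qed.

(** * From edge counts to minima *)

Lemma le_min_edges (n : nat) (P : graph 'I_n -> Prop) (m : nat) :
  (forall G, P G -> m <= #|edges G|) -> (m%:Z%:E <= min_edges P)%E.
Proof.
(* The first goal concerns the default value [+oo] of the minimum. *)
move=> mP; apply: Order.POrderTheory.le_bigmin => [|G /asboolP /mP mG].
  exact: leey.
by rewrite lee_fin.
Qed.

Lemma sub_min_edges (n : nat) (P Q : graph 'I_n -> Prop) :
  (forall G, P G -> Q G) -> (min_edges Q <= min_edges P)%E.
Proof.
move=> PQ; apply: Order.POrderTheory.le_bigmin => [|G /asboolP /PQ /asboolP QG].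
  exact: leey.
exact: Order.TotalTheory.bigmin_le_cond.
Qed.

Theorem theorem1p5 (n : nat) (n_gt0 : (0 < n)%N) :
  (forall (U : finType) (H : graph U), ~ has_isolated_edge H ->
     (ssat n H <= sat_star n H)%E /\
     (((n./2)%:Z)%:E <= ssat n H)%E) /\
  (forall (U : finType) (H : graph U), connected H -> has_cycle H ->
     (ssat n H <= sat_star n H)%E /\
     (((n - 1)%N%:Z)%:E <= ssat n H)%E).
Proof.
have le U (H : graph U) : (ssat n H <= sat_star n H)%E.
  by apply: sub_min_edges => G; apply: properly_rainbow_saturated_semi.
split=> U H.
  move=> nH; split=> //; apply: le_min_edges => G sG.
  by rewrite -{1}(card_ord n); apply: card_edges_semi_saturated nH sG.
move=> cH cyH; split=> //; apply: le_min_edges => G sG.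
rewrite leq_subLR addnC -{1}(card_ord n).
exact: card_edges_semi_saturated_cycle cH cyH sG.
Qed.
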